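(* Let $X$ be a Hausdorff topological space, and let $\Gamma\subset\mathrm{Homeo}(X)$ be a subgroup. (1) If $\Gamma$ has small supports everywhere, then $\Gamma$ recognizes maps in $\mathrm{Homeo}(X)$. (2) If $\Gamma$ has the contraction property, then $\Gamma$ recognizes maps in $\mathcal{C}=\{f\in\mathrm{Homeo}(X)\mid \mathrm{Supp}(f)\neq X\}$, i.e. homeomorphisms of $X$ with non total support.
   Context: For $\gamma\in\mathrm{Homeo}(X)$, $\mathrm{Supp}(\gamma)$ is the closure of $\{x\in X\mid \gamma(x)\neq x\}$. A group $\Gamma\subset\mathrm{Homeo}(X)$ has small supports everywhere if for every nonempty open set $U\subset X$ there exists $\gamma\in\Gamma\smallsetminus\{\mathrm{id}\}$ with $\mathrm{Supp}(\gamma)\subset U$. $\Gamma$ has the contraction property if for every nonempty open set $U\subset X$ there exists $\gamma\in\Gamma$ such that $\gamma(X\smallsetminus U)\subset U$. For a subset $\mathcal{C}\subset\mathrm{Homeo}(X)$, $\Gamma$ recognizes maps in $\mathcal{C}$ if for every $f\in\mathcal{C}$ and every $h\in\mathrm{Homeo}(X)$, the existence of a group isomorphism $\phi\colon\langle\Gamma,f\rangle\to\langle\Gamma,h\rangle$ with $\phi|_\Gamma=\mathrm{id}_\Gamma$ and $\phi(f)=h$ implies $h=f$. Here $\langle\Gamma,f\rangle$ is the subgroup of $\mathrm{Homeo}(X)$ generated by $\Gamma$ and $f$. *)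

(* Defs.v *)
From HB Require Import structures.
From mathcomp Require Import all_boot.
From mathcomp Require Import boolp classical_sets functions topology.

Set Implicit Arguments.
Unset Strict Implicit.
Unset Printing Implicit Defensive.

Local Open Scope classical_set_scope.
Local Open Scope group_scope.

Section Subgroups.
Variable G : groupType.

Definition subgroup (A : set G) : Prop := group_closed [in A].

Definition gen_subgroup (A : set G) : set G := smallest subgroup A.

End Subgroups.

(* An isomorphism from the subgroup A onto the subgroup B is encoded, as with
   MathComp's morphisms with a domain, by a total function whose values outside
   A are irrelevant. *)
Definition subgroup_iso (G H : groupType) (A : set G) (B : set H)
    (phi : G -> H) : Prop :=
  set_bij A B phi /\ {in A &, {morph phi : x y / x * y}}.

Section HomeoDef.
Variable X : topologicalType.

Record homeo := Homeo {
  homeo_fun :> X -> X;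
  homeo_inv : X -> X;
  homeo_continuous : continuous homeo_fun;
  homeo_inv_continuous : continuous homeo_inv;
  homeoK : cancel homeo_fun homeo_inv;
  homeoVK : cancel homeo_inv homeo_fun
}.

Lemma homeoP (f g : homeo) : f = g <-> f =1 g.
Proof.
split=> [-> //|]; case: f g => [f f' cf cf' fK f'K] [g g' cg cg' gK g'K] /= fg.
have efg : f = g by apply/funext.
subst g.
have e' : f' = g' by apply/funext => x; apply: (can_inj fK); rewrite f'K g'K.
by subst g'; congr Homeo; apply: Prop_irrelevance.
Qed.

Definition homeo_one : homeo :=
  @Homeo id id (fun x => @cvg_id _ (nbhs x)) (fun x => @cvg_id _ (nbhs x))
    (fun=> erefl) (fun=> erefl).

Definition homeo_mul (f g : homeo) : homeo :=
  @Homeo (f \o g) (homeo_inv g \o homeo_inv f)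
    (fun x => continuous_comp (@homeo_continuous g x)
                              (@homeo_continuous f (g x)))
    (fun x => continuous_comp (@homeo_inv_continuous f x)
                              (@homeo_inv_continuous g (homeo_inv f x)))
    (can_comp (@homeoK f) (@homeoK g)) (can_comp (@homeoVK g) (@homeoVK f)).

Definition homeo_invg (f : homeo) : homeo :=
  Homeo (@homeo_inv_continuous f) (@homeo_continuous f) (@homeoVK f) (@homeoK f).

Lemma homeo_mulA : associative homeo_mul.
Proof. by move=> f g h; apply/homeoP. Qed.

Lemma homeo_1mul : left_id homeo_one homeo_mul.
Proof. by move=> f; apply/homeoP. Qed.

Lemma homeo_mul1 : right_id homeo_one homeo_mul.
Proof. by move=> f; apply/homeoP. Qed.

Lemma homeo_mulVf : left_inverse homeo_one homeo_invg homeo_mul.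
Proof. by move=> f; apply/homeoP => x /=; rewrite homeoK. Qed.

Lemma homeo_mulfV : right_inverse homeo_one homeo_invg homeo_mul.
Proof. by move=> f; apply/homeoP => x /=; rewrite homeoVK. Qed.

End HomeoDef.

HB.instance Definition _ (X : topologicalType) := gen_eqMixin (homeo X).
HB.instance Definition _ (X : topologicalType) := gen_choiceMixin (homeo X).
HB.instance Definition _ (X : topologicalType) :=
  isGroup.Build (homeo X) (@homeo_mulA X) (@homeo_1mul X) (@homeo_mul1 X)
    (@homeo_mulVf X) (@homeo_mulfV X).

Section Properties.
Variable X : topologicalType.
Implicit Types (f g h : homeo X) (U : set X) (Gamma C : set (homeo X)).

Definition Supp f : set X := closure [set x | f x <> x].

Definition small_supports_everywhere Gamma : Prop :=
  forall U, open U -> U !=set0 ->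
    exists g, [/\ Gamma g, g <> 1 & Supp g `<=` U].

Definition contraction_property Gamma : Prop :=
  forall U, open U -> U !=set0 ->
    exists g, Gamma g /\ g @` (~` U) `<=` U.

Definition recognizes_maps_in Gamma C : Prop :=
  forall f h, C f ->
    (exists phi : homeo X -> homeo X,
      [/\ subgroup_iso (gen_subgroup (Gamma `|` [set f]))
                       (gen_subgroup (Gamma `|` [set h])) phi,
          {in Gamma, forall g, phi g = g} & phi f = h]) ->
    h = f.

End Properties.

(* Main.v *)
Require Import Defs.
From mathcomp Require Import all_boot.
From mathcomp Require Import boolp classical_sets functions topology.

(** An isomorphism [phi] that fixes [Gamma] and maps [f] to [h] preserves and
    reflects commutation.  Commutation sees the topology: homeomorphisms
    supported in disjoint sets commute, whereas [k] does not commute with a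
    nontrivial homeomorphism supported in a set that [k] moves off itself.

    Suppose that every nonempty open set [V] carries a nontrivial [k] in the
    domain of [phi] such that both [k] and [phi k] are supported in [V]
    ([localized]).  If [f x <> h x], then [f V] and [h V] are disjoint for some
    neighbourhood [V] of [x].  Take such a [k] in [f V], a set [W] in [f V] with
    [k W] disjoint from [W], and such a [g] in the intersection of [V] and the
    preimage of [W] under [f].  Then [k] does not commute with [f * g * f^-1],
    which is supported in [W]; but [phi k], supported in [f V], commutes with
    [h * phi g * h^-1], supported in [h V].  This contradiction gives [h = f]
    ([localized_iso_eq]).

    If [Gamma] has small supports, its own elements, fixed by [phi], serve as
    the [k].  If [Gamma] has the contraction property and [f <> 1] is trivial on
    a nonempty open set [U], the conjugates [c * f * c^-1] with [c] in [Gamma]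
    serve: such a [c] can push the complement of [U] into any prescribed [V]
    ([contraction_into]), so [c * f * c^-1] is supported in [V].  It remains to
    see that its image [c * h * c^-1] is supported in [V] too, i.e. that [h] is
    also trivial on [U].  This is [contraction_trivial_on]: when [h] moves a
    point of [U], a contraction [c] towards a small set [W] around that point
    makes [c * f * c^-1] commute with [f], which [c * h * c^-1] and [h] can
    imitate only in a space with at most two points, where [f = 1]. *)

Set Implicit Arguments.
Unset Strict Implicit.
Unset Printing Implicit Defensive.

Local Open Scope classical_set_scope.
Local Open Scope group_scope.

(** * Subgroup isomorphisms and commutation *)

Section SubgroupIso.
Variables (G H : groupType) (A : set G) (B : set H) (phi : G -> H).
Hypotheses (sA : subgroup A) (isoAB : subgroup_iso A B phi).

Lemma subgroup1 : A 1.
Proof. by case: sA => /set_mem. Qed.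

Lemma subgroupV x : A x -> A x^-1.
Proof. by move=> Ax; apply/set_mem/(group_closedV sA)/mem_set. Qed.

Lemma subgroupM x y : A x -> A y -> A (x * y).
Proof.
by move=> Ax Ay; apply/set_mem; apply: (group_closedM sA); apply: mem_set.
Qed.

Lemma subgroup_isoM x y : A x -> A y -> phi (x * y) = phi x * phi y.
Proof. by move=> Ax Ay; case: isoAB => _; apply; apply: mem_set. Qed.

Lemma subgroup_iso_inj x y : A x -> A y -> phi x = phi y -> x = y.
Proof.
by move=> Ax Ay; case: isoAB => [[_ inj _] _]; apply: inj; apply: mem_set.
Qed.

Lemma subgroup_iso1 : phi 1 = 1.
Proof.
apply: (mulgI (phi 1)).
by rewrite mulg1 -subgroup_isoM ?mulg1 //; exact: subgroup1.
Qed.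

Lemma subgroup_isoV x : A x -> phi x^-1 = (phi x)^-1.
Proof.
move=> Ax; apply: (mulgI (phi x)); rewrite mulgV -subgroup_isoM ?mulgV //.
  exact: subgroup_iso1.
exact: subgroupV.
Qed.

Lemma subgroup_isoJ x y : A x -> A y ->
  phi (x * y * x^-1) = phi x * phi y * (phi x)^-1.
Proof.
move=> Ax Ay; have AVx := subgroupV Ax; have Axy := subgroupM Ax Ay.
by rewrite !subgroup_isoM // subgroup_isoV.
Qed.

Lemma subgroup_iso_commute x y : A x -> A y ->
  commute x y <-> commute (phi x) (phi y).
Proof.
rewrite /commute => Ax Ay; rewrite -!subgroup_isoM //; split=> [-> //|].
by apply: subgroup_iso_inj; apply: subgroupM.
Qed.

End SubgroupIso.

Lemma gen_subgroup_subgroup (G : groupType) (A : set G) :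
  subgroup (gen_subgroup A).
Proof.
split; first by apply: mem_set => B [/subgroup1].
move=> x y /set_mem Ax /set_mem Ay; apply: mem_set => B BA; have sB := BA.1.
by apply: subgroupM => //; [exact: Ax | apply: subgroupV => //; exact: Ay].
Qed.

(** * Supports and commutation of homeomorphisms *)

Section Homeo.
Variable X : topologicalType.
Implicit Types (f g h k c : homeo X) (U V W : set X).

Lemma homeo_inj f : injective f.
Proof. exact: can_inj (@homeoK _ f). Qed.

Lemma homeo_mulVK f x : f (f^-1 x) = x.
Proof. exact: homeoVK. Qed.

Lemma open_preimage f V : open V -> open (f @^-1` V).
Proof. by apply: (continuousP _).1; exact: homeo_continuous. Qed.

Lemma open_preimageV f V : open V -> open ((f^-1)%g @^-1` V).
Proof. exact: open_preimage. Qed.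

Lemma homeo_neq1 f : f <> 1 -> exists x, f x <> x.
Proof.
move=> f1; apply: contrapT => nex; apply: f1; apply/homeoP => x.
by apply: contrapT => fx; apply: nex; exists x.
Qed.

Lemma commuteE f g : commute f g <-> forall x, f (g x) = g (f x).
Proof. exact: homeoP. Qed.

(** No closure is taken, unlike in [Supp]: pointwise triviality off [V] is what
    the commutation arguments use, and it behaves well under conjugation even
    when [V] is open. *)
Definition supported_in f V := forall x, ~ V x -> f x = x.

Lemma Supp_supported_in f V : Supp f `<=` V -> supported_in f V.
Proof.
by move=> sfV x nVx; apply: contrapT => fx; apply/nVx/sfV/subset_closure.
Qed.

Lemma supported_in_stable f V x : supported_in f V -> V x -> V (f x).
Proof.
move=> fV Vx; apply: contrapT => nV.
by apply: (nV); rewrite (homeo_inj (fV _ nV)).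
Qed.

Lemma supported_in_conj f g V W :
  supported_in f V -> V `<=` g @^-1` W -> supported_in (g * f * g^-1) W.
Proof.
move=> fV VW x nWx; change (g (f (g^-1 x)) = x).
rewrite fV ?homeo_mulVK // => /VW /=.
by rewrite homeo_mulVK.
Qed.

Lemma disjoint_supports_commute f g V W :
  supported_in f V -> supported_in g W -> V `<=` ~` W -> commute f g.
Proof.
move=> fV gW VW; apply/commuteE => x; have [Vx|nVx] := pselect (V x).
  by rewrite !gW //; apply: VW => //; exact: supported_in_stable.
rewrite (fV _ nVx) fV // => /[dup] Vgx /VW nWgx.
by apply: nVx; rewrite -(homeo_inj (gW _ nWgx)).
Qed.

(** Commuting with [k] makes the support of [g] invariant under [k], so a
    support that [k] displaces must be empty. *)
Lemma displaced_support_eq1 k g W :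
  supported_in g W -> W `<=` k @^-1` (~` W) -> commute k g -> g = 1.
Proof.
move=> gW kW /commuteE kg; apply/homeoP => x.
have [Wx|] := pselect (W x); last exact: gW.
by apply: (@homeo_inj k); rewrite kg gW //; exact: kW.
Qed.

Hypothesis hausX : hausdorff_space X.

Lemma hausdorff_separate (x y : X) : x <> y ->
  exists U V, [/\ open U, open V, U x, V y & U `<=` ~` V].
Proof.
move=> /eqP xy; have := hausX; rewrite open_hausdorff => /(_ _ _ xy).
move=> [[U V] /= [/set_mem Ux /set_mem Vy] [oU oV /eqP UV0]].
exists U, V; split=> // z Uz Vz.
by have : (U `&` V) z by []; rewrite UV0.
Qed.

Lemma homeo_separate f g x : f x <> g x ->
  exists V, [/\ open V, V x & forall y z, V y -> V z -> f y <> g z].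
Proof.
move=> /hausdorff_separate[A [B [oA oB Afx Bgx AB]]].
exists (f @^-1` A `&` g @^-1` B); split=> //.
  by apply: openI; exact: open_preimage.
by move=> y z [Afy _] [_ Bgz] e; apply: (AB _ Afy); rewrite e.
Qed.

(** * Isomorphisms that respect arbitrarily small supports *)

Section Localized.
Variables (A B : set (homeo X)) (phi : homeo X -> homeo X).
Hypotheses (sA : subgroup A) (isoAB : subgroup_iso A B phi).

Definition localized := forall V, open V -> V !=set0 ->
  exists k, [/\ A k, k <> 1, supported_in k V & supported_in (phi k) V].

(** Where [f] and [phi f] disagree, they carry a small support to two disjoint
    sets, and an element located near the first of them distinguishes the two
    conjugates by whether they commute with it. *)
Lemma localized_iso_eq f : localized -> A f -> phi f = f.
Proof.
move=> loc Af; apply/homeoP => x; apply: contrapT => hfx.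
have /homeo_separate[V [oV Vx sep]] : f x <> phi f x by move/esym.
have [||k [Ak k1 kfV pkfV]] := loc ((f^-1)%g @^-1` V).
- exact: open_preimageV.
- by exists (f x); rewrite /preimage /= homeoK.
have [y ky] := homeo_neq1 k1.
have fVy : V (f^-1 y) by apply: contrapT => /kfV.
have /(@homeo_separate k 1)[W [oW Wy kW]] : k y <> (1 : homeo X) y by [].
have [||g [Ag g1 gV pgV]] := loc (V `&` f @^-1` W).
- by apply: openI => //; exact: open_preimage.
- by exists (f^-1 y); split=> //; rewrite /preimage /= homeo_mulVK.
have Aj : A (f * g * f^-1).
  by apply: subgroupM => //; [apply: subgroupM | apply: subgroupV].
have kj : commute k (f * g * f^-1).
  apply/(subgroup_iso_commute sA isoAB Ak Aj).
  rewrite (subgroup_isoJ sA isoAB) //.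
  apply: (@disjoint_supports_commute _ _ _ (phi f @` V) pkfV).
    by apply: (supported_in_conj pgV) => z [Vz _]; exists z.
  move=> z Vz [w Vw hw]; apply: (sep _ _ Vz Vw).
  by rewrite homeo_mulVK hw.
have jW : supported_in (f * g * f^-1) W.
  by apply: supported_in_conj gV _ => z [].
have /(displaced_support_eq1 jW)/(_ kj) j1 : W `<=` k @^-1` (~` W).
  by move=> z Wz Wkz; exact: (kW z (k z)).
apply: g1; apply: (mulgI f); apply: (mulIg f^-1).
by rewrite j1 mulg1 mulgV.
Qed.

End Localized.

(** * Contractions *)

Section Contraction.
Variable Gamma : set (homeo X).
Hypotheses (sG : subgroup Gamma) (contr : contraction_property Gamma).

(** A contraction towards [V] brings a point of [U] into [V], so some translate
    of [V] meets [U]; a contraction towards the intersection, followed by the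
    translation, does the job. *)
Lemma contraction_into U V : open U -> U !=set0 -> open V -> V !=set0 ->
  exists c, Gamma c /\ ~` U `<=` c @^-1` V.
Proof.
move=> oU [u Uu] oV V0.
have [g [Gg Vgu]] : exists g, Gamma g /\ V (g u).
  have [Vu|nVu] := pselect (V u).
    by exists 1; split=> //; exact: subgroup1.
  by have [g [Gg gV]] := contr oV V0; exists g; split=> //; apply: gV; exists u.
have [||c [Gc cW]] := contr (U := U `&` g @^-1` V).
- by apply: openI => //; exact: open_preimage.
- by exists u.
exists (g * c); split; first exact: subgroupM.
move=> x nUx; suff [] : (U `&` g @^-1` V) (c x) by [].
by apply: cW; exists x => // -[].
Qed.

(** Let [h] move [y] in [U], and let [W] be a neighbourhood of [y] in [U] that
    [h] displaces.  Let [c] contract the complement of [W] into [W].  Then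
    [c * f * c^-1] is supported in [W], hence commutes with [f], while
    [c * h * c^-1] maps the complement of [W] into [W], because [h] maps [W]
    off itself.  As [c * h * c^-1] commutes with [h], this forces every point
    to lie in [W] or in [h^-1 W].  Since that also holds for every smaller
    neighbourhood of [y], the set [W] is [{y}]; so the space consists of [y] and
    [h^-1 y], and [f], which fixes [y], is trivial. *)
Lemma contraction_trivial_on f h U : open U -> f <> 1 ->
  supported_in f (~` U) ->
  (forall c, Gamma c -> commute f (c * f * c^-1) -> commute h (c * h * c^-1)) ->
  supported_in h (~` U).
Proof.
move=> oU f1 fU comm y /contrapT Uy; apply: contrapT => hy; apply: f1.
have /(@homeo_separate h 1)[V [oV Vy hV]] : h y <> (1 : homeo X) y by [].
have fixU z : U z -> f z = z by move=> Uz; apply: fU; apply.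
have covers W : open W -> W y -> W `<=` U `&` V -> forall x, W x \/ W (h x).
  move=> oW Wy WUV x; apply: contrapT => /not_orP[nWx nWhx].
  have hW z : W z -> ~ W (h z).
    by move=> Wz /WUV[_ Vhz]; have [_ Vz] := WUV _ Wz; exact: (hV z (h z)).
  have [|c [Gc cW]] := contr oW; first by exists y.
  have {}cW z : ~ W z -> W (c z) by move=> nWz; apply: cW; exists z.
  have /(comm _ Gc)/commuteE/(_ x) : commute f (c * f * c^-1).
    apply: (@disjoint_supports_commute _ _ _ W fU).
      by apply: supported_in_conj fU _ => z nUz; apply: cW => /WUV[].
    by move=> z nUz /WUV[].
  have chcW z : ~ W z -> W ((c * h * c^-1) z).
    move=> nWz; apply: (cW (h (c^-1 z))); apply: hW; apply: contrapT => /cW.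
    by rewrite homeo_mulVK.
  move=> e; apply: (hW _ (chcW _ nWx)).
  by rewrite e; exact: chcW.
have UVy x : (U `&` V) x -> x = y.
  move=> [Ux Vx]; apply: contrapT => /hausdorff_separate[M [N [_ oN Mx Ny MN]]].
  have [||z [[Uz Vz] _] //|[[_ Vz] Nz]|[[_ Vhx] _]] :=
      covers (U `&` V `&` N) _ _ _ x.
  - by apply: openI => //; exact: openI.
  - by [].
  - exact: (MN x).
  - exact: (hV x (h x)).
apply/homeoP => x /=.
(* The space is reduced to [y] and the preimage of [y] under [h]. *)
have dich z : z = y \/ h z = y.
  have [||//|/UVy|/UVy] := covers (U `&` V) _ _ _ z; [exact: openI|by []| |].
    by left.
  by right.
have fy : f y = y by exact: fixU.
have [->//|hx] := dich x.
have [fxy|hfx] := dich (f x).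
  by rewrite fxy; apply: (@homeo_inj f); rewrite fxy fy.
by apply: (@homeo_inj h); rewrite hfx hx.
Qed.

End Contraction.

End Homeo.

Theorem theorem1p2 (X : topologicalType) (Gamma : set (homeo X))
    (hausX : hausdorff_space X) (subGamma : subgroup Gamma) :
  (small_supports_everywhere Gamma ->
     recognizes_maps_in Gamma [set: homeo X]) /\
  (contraction_property Gamma ->
     recognizes_maps_in Gamma [set f : homeo X | Supp f <> [set: X]]).
Proof.
split=> [small|contr] f h Cf [phi [iso phiG <-]].
all: set A := gen_subgroup (Gamma `|` [set f]) in iso.
all: have sA : subgroup A by exact: gen_subgroup_subgroup.
all: have Af : A f by apply: sub_gen_smallest; right.
all: have GA g : Gamma g -> A g by move=> Gg; apply: sub_gen_smallest; left.
all: have {}phiG g : Gamma g -> phi g = g by move/mem_set/phiG.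
  apply: (localized_iso_eq hausX sA iso) Af => V oV V0.
  have [k [Gk k1 /Supp_supported_in kV]] := small V oV V0.
  by exists k; split=> //; [exact: GA | rewrite phiG].
have [->|f1] := pselect (f = 1); first exact: (subgroup_iso1 sA iso).
pose U := ~` Supp f.
have oU : open U by apply: closed_openC; exact: closed_closure.
have U0 : U !=set0.
  apply: contrapT => U0; apply: Cf; rewrite -subTset => x _.
  by apply: contrapT => nfx; apply: U0; exists x.
have fU : supported_in f (~` U) by rewrite setCK; exact: Supp_supported_in.
have AJ c : Gamma c -> A (c * f * c^-1).
  move=> /GA Ac; apply: (subgroupM sA (subgroupM sA Ac Af)).
  exact: (subgroupV sA).
have phiJ c : Gamma c -> phi (c * f * c^-1) = c * phi f * c^-1.
  by move=> Gc; rewrite (subgroup_isoJ sA iso (GA c Gc) Af) (phiG c Gc).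
have hU : supported_in (phi f) (~` U).
  apply: (contraction_trivial_on hausX contr oU f1 fU) => c Gc.
  by rewrite -phiJ //; apply: (subgroup_iso_commute sA iso Af (AJ c Gc)).1.
apply: (localized_iso_eq hausX sA iso) Af => V oV V0.
have [c [Gc cV]] := contraction_into subGamma contr oU U0 oV V0.
exists (c * f * c^-1); split.
- exact: AJ.
- move=> e; apply: f1; apply: (mulgI c); apply: (mulIg c^-1).
  by rewrite e mulg1 mulgV.
- exact: supported_in_conj fU cV.
- by rewrite phiJ //; exact: (supported_in_conj hU cV).
Qed.
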